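(* There are no rigid $4$-dimensional complex nilpotent $\mathfrak{CD}$-algebras. That is, let $V$ be a $4$-dimensional complex vector space and let $\mathcal{N}\subset \mathrm{Hom}(V\otimes V,V)\cong\mathbb{C}^{64}$ be the variety of all nilpotent $\mathfrak{CD}$-algebra structures on $V$; then there is no $\mu\in\mathcal{N}$ whose $\mathrm{GL}(V)$-orbit $O(\mu)$ is a Zariski-open subset of $\mathcal{N}$.
   Context: All algebras are over $\mathbb{C}$ and are not assumed associative, commutative, anticommutative or unital. For an algebra $A$ and $x\in A$ let $L_x(z)=xz$ and $R_x(z)=zx$ be the left and right multiplication operators. $A$ is a $\mathfrak{CD}$-algebra if the commutator of any pair of multiplication operators is a derivation of $A$, i.e. $[L_x,L_y]$, $[L_x,R_y]$ and $[R_x,R_y]$ are derivations of $A$ for all $x,y\in A$. An algebra $A$ is nilpotent if there is $n\geq 1$ such that $A^n=0$, where $A^1=A$ and $A^{n}=\sum_{i=1}^{n-1}A^iA^{n-i}$ (equivalently, all products of $n$ elements of $A$, with any arrangement of brackets, vanish for some $n$). For an $n$-dimensional complex vector space $V$ with a fixed basis $e_1,\dots,e_n$, an algebra structure $\mu\in\mathrm{Hom}(V\otimes V,V)$ is identified with its structure constants $(c_{i,j}^k)\in\mathbb{C}^{n^3}$, $\mu(e_i\otimes e_j)=\sum_k c_{i,j}^k e_k$, and $\mathrm{Hom}(V\otimes V,V)$ carries the Zariski topology of $\mathbb{C}^{n^3}$. The group $\mathrm{GL}(V)$ acts by $(g*\mu)(x\otimes y)=g\mu(g^{-1}x\otimes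 g^{-1}y)$, and $O(\mu)$ is the orbit of $\mu$. An algebra represented by $\mu\in\mathcal{N}$ is rigid in $\mathcal{N}$ if $O(\mu)$ is an open subset of $\mathcal{N}$. *)

(* Defs.v *)
From HB Require Import structures.
From mathcomp Require Import all_boot all_order all_algebra.
From mathcomp Require Import classical_sets reals.
From mathcomp Require Import complex mpoly.

Set Implicit Arguments.
Unset Strict Implicit.
Unset Printing Implicit Defensive.

Import GRing.Theory.

Local Open Scope ring_scope.

Section Algebras.
Variables (K : fieldType) (n : nat).

Local Notation V := 'cV[K]_n.

(* Hom(V (x) V, V) for V = K^n with its standard basis: mu (i, j, k) is the
   coefficient c_{i,j}^k of e_k in the product e_i e_j. *)
Definition alg_struct := {ffun 'I_n * 'I_n * 'I_n -> K}.

Definition basis_vec (i : 'I_n) : V := delta_mx i 0.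

Definition amul (mu : alg_struct) (x y : V) : V :=
  \col_k \sum_i \sum_j x i 0 * y j 0 * mu (i, j, k).

Definition lmulop (mu : alg_struct) (x : V) : V -> V := fun z => amul mu x z.
Definition rmulop (mu : alg_struct) (x : V) : V -> V := fun z => amul mu z x.

Definition op_comm (f g : V -> V) : V -> V := fun z => f (g z) - g (f z).

Definition derivation (mu : alg_struct) (D : V -> V) : Prop :=
  linear D /\
  forall x y : V, D (amul mu x y) = amul mu (D x) y + amul mu x (D y).

Definition CD_algebra (mu : alg_struct) : Prop :=
  forall x y : V,
    [/\ derivation mu (op_comm (lmulop mu x) (lmulop mu y)),
        derivation mu (op_comm (lmulop mu x) (rmulop mu y)) &
        derivation mu (op_comm (rmulop mu x) (rmulop mu y))].

(* The span of all products x y with x in U and y in W, generated by the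
   products of basis vectors; see subspace_mulP. *)
Definition subspace_mul (mu : alg_struct) (U W : {vspace V}) : {vspace V} :=
  <<[seq amul mu x y | x <- vbasis U, y <- vbasis W]>>%VS.

(* The sequence A^1, ..., A^m; the entry of index i is A^(i+1). *)
Fixpoint alg_powers (mu : alg_struct) (m : nat) : seq {vspace V} :=
  if m is m'.+1 then
    let s := alg_powers mu m' in
    rcons s (if m' == 0%N then fullv
             else \sum_(i < m')
                    subspace_mul mu (nth fullv s i) (nth fullv s (m' - i.+1)))%VS
  else [::].

(* A^m for m >= 1; see alg_pow1 and alg_powE. *)
Definition alg_pow (mu : alg_struct) (m : nat) : {vspace V} :=
  nth fullv (alg_powers mu m) m.-1.

Definition nilpotent_algebra (mu : alg_struct) : Prop :=
  exists2 m : nat, (1 <= m)%N & alg_pow mu m = 0%VS.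

Definition nilpotent_CD : set alg_struct :=
  [set mu | nilpotent_algebra mu /\ CD_algebra mu]%classic.

(* The structure constants of g * mu; see amul_gl_act. *)
Definition gl_act (g : 'M[K]_n) (mu : alg_struct) : alg_struct :=
  [ffun t : 'I_n * 'I_n * 'I_n =>
     (g *m amul mu (invmx g *m basis_vec t.1.1) (invmx g *m basis_vec t.1.2))
       t.2 0].

Definition gl_orbit (mu : alg_struct) : set alg_struct :=
  [set nu | exists2 g : 'M[K]_n, g \in unitmx & nu = gl_act g mu]%classic.

(* Polynomials in the n^3 structure constants; the variables are numbered by
   the enumeration of the index triples. *)
Definition struct_eval (p : {mpoly K[#|{: 'I_n * 'I_n * 'I_n}|]})
    (mu : alg_struct) : K :=
  p.@[fun i => mu (enum_val i)].

Definition zariski_closed (Z : set alg_struct) : Prop :=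
  exists S : set {mpoly K[#|{: 'I_n * 'I_n * 'I_n}|]},
    Z = [set mu | forall p, S p -> struct_eval p mu = 0]%classic.

Definition zariski_open (U : set alg_struct) : Prop := zariski_closed (~` U)%classic.

(* Openness for the subspace topology induced on X. *)
Definition zariski_open_in (X O : set alg_struct) : Prop :=
  exists2 U : set alg_struct, zariski_open U & O = (X `&` U)%classic.

Definition rigid_in (X : set alg_struct) (mu : alg_struct) : Prop :=
  X mu /\ zariski_open_in X (gl_orbit mu).

Lemma amul_linearl mu y : linear (amul mu ^~ y).
Proof.
move=> a x x'; apply/colP=> k; rewrite !mxE big_distrr -big_split /=.
apply: eq_bigr => i _; rewrite big_distrr -big_split /=.
by apply: eq_bigr => j _; rewrite !mxE !mulrDl !mulrA.
Qed.

Lemma amul_linearr mu x : linear (amul mu x).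
Proof.
move=> a y y'; apply/colP=> k; rewrite !mxE big_distrr -big_split /=.
apply: eq_bigr => i _; rewrite big_distrr -big_split /=.
apply: eq_bigr => j _; rewrite !mxE mulrDr mulrDl.
by rewrite !mulrA (mulrC (x i 0) a).
Qed.

Lemma amul_suml mu I r (P : pred I) (a : I -> K) (F : I -> V) y :
  amul mu (\sum_(i <- r | P i) a i *: F i) y =
  \sum_(i <- r | P i) a i *: amul mu (F i) y.
Proof.
have f0 : amul mu 0 y = 0.
  by have /eqP := amul_linearl mu y 1 0 0; rewrite !scale1r addr0 -subr_eq subrr => /eqP.
apply: (big_rec2 (fun u v => amul mu u y = v)) => // i u v _ <-.
exact: amul_linearl.
Qed.

Lemma amul_sumr mu I r (P : pred I) (a : I -> K) (F : I -> V) x :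
  amul mu x (\sum_(i <- r | P i) a i *: F i) =
  \sum_(i <- r | P i) a i *: amul mu x (F i).
Proof.
have f0 : amul mu x 0 = 0.
  by have /eqP := amul_linearr mu x 1 0 0; rewrite !scale1r addr0 -subr_eq subrr => /eqP.
apply: (big_rec2 (fun u v => amul mu x u = v)) => // i u v _ <-.
exact: amul_linearr.
Qed.

Lemma amul_basis mu i j k : amul mu (basis_vec i) (basis_vec j) k 0 = mu (i, j, k).
Proof.
rewrite mxE (bigD1 i) //= (bigD1 j) //= !mxE !eqxx !mul1r.
rewrite !big1 ?addr0 // => [i' /negPf ne | j' /negPf ne].
  by rewrite big1 // => j' _; rewrite !mxE ne /= !mul0r.
by rewrite !mxE ne /= mulr0 mul0r.
Qed.

Lemma vec_sum (x : V) : x = \sum_i x i 0 *: basis_vec i.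
Proof.
rewrite {1}[x]matrix_sum_delta; apply: eq_bigr => i _.
by rewrite big_ord1.
Qed.

Lemma amul_gl_act g mu x y :
  amul (gl_act g mu) x y = g *m amul mu (invmx g *m x) (invmx g *m y).
Proof.
rewrite [in RHS](vec_sum x) [in RHS](vec_sum y) !mulmx_sumr.
under [X in amul mu X _]eq_bigr do rewrite -scalemxAr.
under [X in amul mu _ X]eq_bigr do rewrite -scalemxAr.
rewrite amul_suml mulmx_sumr; apply/colP=> k; rewrite mxE summxE.
apply: eq_bigr => i _; rewrite amul_sumr -scalemxAr mulmx_sumr mxE summxE.
rewrite big_distrr; apply: eq_bigr => j _ /=.
by rewrite -scalemxAr mxE ffunE /= !mulrA.
Qed.

Lemma subspace_mulP mu (U W Z : {vspace V}) :
  (subspace_mul mu U W <= Z)%VS <->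
  (forall x y, x \in U -> y \in W -> amul mu x y \in Z).
Proof.
split=> [/span_subvP sub x y xU yW | sub].
  rewrite (coord_vbasis xU) (coord_vbasis yW) amul_suml.
  apply: memv_suml => i _; rewrite memvZ // amul_sumr.
  apply: memv_suml => j _; rewrite memvZ // sub //.
  by apply/allpairsP; exists ((vbasis U)`_i, (vbasis W)`_j); rewrite /= !mem_nth ?size_tuple.
apply/span_subvP => _ /allpairsP[[x y] [/= xU yW ->]].
by apply: sub; apply: vbasis_mem.
Qed.

Lemma size_alg_powers mu m : size (alg_powers mu m) = m.
Proof. by elim: m => //= m IH; rewrite size_rcons IH. Qed.

Lemma nth_alg_powers mu m i :
  (i < m)%N -> nth fullv (alg_powers mu m) i = alg_pow mu i.+1.
Proof.
elim: m => // m IH; rewrite ltnS leq_eqVlt => /predU1P[-> // | lt_im].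
by rewrite /= nth_rcons size_alg_powers lt_im IH.
Qed.

Lemma alg_pow1 mu : alg_pow mu 1 = fullv.
Proof. by []. Qed.

Lemma alg_powE mu m : (2 <= m)%N ->
  alg_pow mu m =
  (\sum_(1 <= i < m) subspace_mul mu (alg_pow mu i) (alg_pow mu (m - i)))%VS.
Proof.
case: m => [|[|m]] // _.
have -> : alg_pow mu m.+2 = nth fullv (rcons (alg_powers mu m.+1)
    (\sum_(i < m.+1) subspace_mul mu (nth fullv (alg_powers mu m.+1) i)
       (nth fullv (alg_powers mu m.+1) (m.+1 - i.+1)))%VS) m.+1 by [].
rewrite nth_rcons size_alg_powers ltnn eqxx.
rewrite big_add1 big_mkord; apply: eq_bigr => i _.
rewrite !nth_alg_powers ?ltn_ord // ?subSS ?ltnS ?leq_subr //.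
by rewrite subSn // -ltnS.
Qed.

End Algebras.

(* Main.v *)
Require Import Defs.
From HB Require Import structures.
From mathcomp Require Import all_boot all_order all_algebra.
From mathcomp Require Import classical_sets reals.
From mathcomp Require Import complex mpoly.
From mathcomp Require Import boolp ring.

(* An open orbit O(mu) in N contains, for every polynomial curve in N that meets
   O(mu), all but finitely many points of the curve.  So it is enough to join a
   point of O(mu), inside N, to a structure violating some identity of mu.

   Take a basis e_0, ..., e_3 in which the product is strictly triangular, with
   e_0 e_0 = a e_1 + ...  If a = 0, then modulo e_3 the product is m(x, y) e_2 for
   a bilinear form m in two variables; every such structure is CD, and the
   modulus of m, the ratio of the determinants of its symmetric and alternating
   parts, is read off from a quartic identity in x and y.  If a <> 0, the CD
   conditions reduce, up to a change of basis that may lead back to a = 0, to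
   e_1 e_1 in <e_3>, e_1 e_2 = e_2 e_1 = e_2 e_2 = 0 and one quadric relating the
   coefficients u, v of e_2 in e_0 e_1, e_1 e_0 to those of e_3 in e_0 e_2,
   e_2 e_0; there the modulus is [u : v], read off from
   y (v x (x x) - u (x x) x) = 0. *)

Set Implicit Arguments.
Unset Strict Implicit.
Unset Printing Implicit Defensive.

Import GRing.Theory.

Local Open Scope ring_scope.

(** * Isomorphism and orbits of structures *)

Section Orbits.
Variables (K : fieldType) (n : nat).
Implicit Types (mu nu : alg_struct K n) (g h : 'M[K]_n) (x y : 'cV[K]_n).

Lemma alg_struct_ext mu nu :
  (forall x y, amul mu x y = amul nu x y) -> mu = nu.
Proof. by move=> eq; apply/ffunP=> -[[i j] k]; rewrite -!amul_basis eq. Qed.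

Lemma amul_gl_actM g mu x y : g \in unitmx ->
  amul (gl_act g mu) (g *m x) (g *m y) = g *m amul mu x y.
Proof. by move=> gU; rewrite amul_gl_act !mulKmx. Qed.

Lemma gl_act_iso g mu nu : g \in unitmx ->
  (forall x y, amul nu (g *m x) (g *m y) = g *m amul mu x y) -> nu = gl_act g mu.
Proof.
move=> gU iso; apply: alg_struct_ext => x y.
by rewrite amul_gl_act -iso !mulKVmx.
Qed.

Lemma gl_orbit_refl mu : gl_orbit mu mu.
Proof.
by exists 1%:M; [apply: unitmx1 | apply: gl_act_iso; rewrite ?unitmx1 // => x y; rewrite !mul1mx].
Qed.

Lemma gl_orbit_trans mu nu xi : gl_orbit mu nu -> gl_orbit nu xi -> gl_orbit mu xi.
Proof.
move=> [g gU ->] [h hU ->]; exists (h *m g); first by rewrite unitmx_mul hU.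
by apply: gl_act_iso => [|x y]; rewrite ?unitmx_mul ?hU // -!mulmxA !amul_gl_actM.
Qed.

Lemma gl_orbit_sym mu nu : gl_orbit mu nu -> gl_orbit nu mu.
Proof.
move=> [g gU ->]; exists (invmx g); first by rewrite unitmx_inv.
by apply: gl_act_iso => [|x y]; rewrite ?unitmx_inv // amul_gl_act mulKmx.
Qed.

End Orbits.

(** * Polynomial curves and open orbits *)

Section PolynomialFunctions.
Variable K : fieldType.
Implicit Types f h : K -> K.

Definition polyfun f := exists p : {poly K}, f =1 horner p.

Lemma polyfun_cst c : polyfun (fun=> c).
Proof. by exists c%:P => t; rewrite hornerC. Qed.

Lemma polyfun_id : polyfun id.
Proof. by exists 'X => t; rewrite hornerX. Qed.

Lemma polyfunD f h : polyfun f -> polyfun h -> polyfun (fun t => f t + h t).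
Proof. by move=> [p fp] [q hq]; exists (p + q) => t; rewrite hornerD fp hq. Qed.

Lemma polyfunM f h : polyfun f -> polyfun h -> polyfun (fun t => f t * h t).
Proof. by move=> [p fp] [q hq]; exists (p * q) => t; rewrite hornerM fp hq. Qed.

Lemma polyfunN f : polyfun f -> polyfun (fun t => - f t).
Proof. by move=> [p fp]; exists (- p) => t; rewrite hornerN fp. Qed.

Lemma polyfunX f m : polyfun f -> polyfun (fun t => f t ^+ m).
Proof. by move=> [p fp]; exists (p ^+ m) => t; rewrite horner_exp fp. Qed.

Definition segment (c d t : K) := c + t * (d - c).

Lemma segment0 c d : segment c d 0 = c.
Proof. by rewrite /segment mul0r addr0. Qed.

Lemma segment1 c d : segment c d 1 = d.
Proof. by rewrite /segment mul1r addrC subrK. Qed.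

Lemma polyfun_segment c d : polyfun (segment c d).
Proof.
apply: polyfunD; first exact: polyfun_cst.
by apply: polyfunM; [apply: polyfun_id | apply: polyfun_cst].
Qed.

Lemma polyfun_bigop I r (P : pred I) (F : I -> K -> K) idx (op : K -> K -> K) :
  (forall f h, polyfun f -> polyfun h -> polyfun (fun t => op (f t) (h t))) ->
  (forall i, polyfun (F i)) ->
  polyfun (fun t => \big[op/idx]_(i <- r | P i) F i t).
Proof.
move=> opP FP; elim: r => [|i r IH].
  by under [X in polyfun X]funext do rewrite big_nil; apply: polyfun_cst.
under [X in polyfun X]funext do rewrite big_cons.
by case: (P i) => //; apply: opP.
Qed.

Lemma polyfun_meval m (v : 'I_m -> K -> K) (p : {mpoly K[m]}) :
  (forall i, polyfun (v i)) -> polyfun (fun t => p.@[v^~ t]).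
Proof.
move=> vP; under [X in polyfun X]funext do rewrite mevalE.
apply: polyfun_bigop => [|M]; first exact: polyfunD.
apply: polyfunM; first exact: polyfun_cst.
apply: polyfun_bigop => [|i]; first exact: polyfunM.
exact: polyfunX.
Qed.

Hypothesis charK : [pchar K] =i pred0.

(** In characteristic zero the [size p] elements 0, 1, 2, ... are distinct, too many to be all roots
    of [p]. *)
Lemma poly_neq0_nonroot (p : {poly K}) : p != 0 -> exists t, p.[t] != 0.
Proof.
move=> pn0; apply: contrapT => /forallNP root_p.
pose rs := [seq i%:R : K | i <- iota 0 (size p)].
suff: (size rs < size p)%N by rewrite size_map size_iota ltnn.
apply: max_poly_roots => //.
  by apply/allP => t _; apply: contrapT => /negP; apply: root_p.
rewrite map_inj_uniq ?iota_uniq // => i j.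
wlog le_ij: i j / (i <= j)%N => [wlog_ij eq_ij|/eqP].
  by case/orP: (leq_total i j) => le; [|symmetry]; apply: wlog_ij.
rewrite eq_sym -subr_eq0 -natrB // (pcharf0P K).1 // subn_eq0 => le_ji.
by apply/eqP; rewrite eqn_leq le_ij.
Qed.

(* The Zariski-open subsets of the affine line are cofinite or empty, and the
   curve meets the open orbit at t = 0. *)
Lemma rigid_curve n (X : set (alg_struct K n)) mu (nu : K -> alg_struct K n)
    (J : K -> K) :
  rigid_in X mu -> (forall t, X (nu t)) -> (forall i, polyfun (fun t => nu t i)) ->
  gl_orbit mu (nu 0) -> polyfun J -> (exists t, J t != 0) ->
  exists2 t, J t != 0 & gl_orbit mu (nu t).
Proof.
move=> [_ [U [S defS] defO]] Xnu nuP nu0 [q Jq] [t0 Jt0].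
have qn0 : q != 0 by apply: contraNneq Jt0 => q0; rewrite Jq q0 horner0.
have Unu0 : U (nu 0) by move: nu0; rewrite defO => -[].
(* One equation of the closed complement of [U] fails at [nu 0]; restricted to the curve it becomes
   a nonzero univariate polynomial [r]. *)
have [p Sp pn0] : exists2 p, S p & struct_eval p (nu 0) != 0.
  apply: contrapT => noS; suff: (~` U)%classic (nu 0) by [].
  rewrite defS => p Sp; apply/eqP; apply: contrapT => /negP pn0.
  by apply: noS; exists p.
have [r rP] : polyfun (fun t => struct_eval p (nu t)).
  by apply: polyfun_meval => i; apply: nuP.
have rn0 : r != 0 by apply: contraNneq pn0 => r0; rewrite rP r0 horner0.
(* At a non-root of [q * r], [J] is nonzero and [p] does not vanish at [nu t], which therefore lies
   in [U]. *)
have [t] := poly_neq0_nonroot (mulf_neq0 qn0 rn0).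
rewrite hornerM mulf_eq0 negb_or -Jq -rP => /andP[Jt pt]; exists t => //.
rewrite defO; split=> //; apply: contrapT => nUt; move: pt.
have: (~` U)%classic (nu t) by [].
by rewrite defS => /(_ p Sp) ->; rewrite eqxx.
Qed.

End PolynomialFunctions.

(** * Nilpotent algebras and strictly triangular bases *)

Section Triangular.
Variables (K : fieldType) (n : nat).
Implicit Types (mu : alg_struct K n) (x y z : 'cV[K]_n).

Definition strictly_triangular mu :=
  forall i j k : 'I_n, (k <= maxn i j)%N -> mu (i, j, k) = 0.

Definition low_coords k x : 'cV[K]_n := \col_i (if (i < k)%N then x i 0 else 0).

Fact low_coords_linear k : linear (low_coords k).
Proof.
by move=> a x y; apply/colP=> i; rewrite !mxE; case: ifP => _; rewrite ?mulr0 ?addr0.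
Qed.

HB.instance Definition _ k :=
  GRing.isLinear.Build K 'cV[K]_n 'cV[K]_n _ (low_coords k) (low_coords_linear k).

(** This is the span of the basis vectors of index at least [k]; the kernel form makes membership a
    condition on coordinates. *)
Definition high_space k : {vspace 'cV[K]_n} := lker (linfun (low_coords k)).

Lemma high_spaceP k x :
  reflect (forall i : 'I_n, (i < k)%N -> x i 0 = 0) (x \in high_space k).
Proof.
rewrite memv_ker lfunE /=; apply: (iffP eqP) => [/colP low0 i lt_ik | x0].
  by have := low0 i; rewrite !mxE lt_ik.
by apply/colP=> i; rewrite !mxE; case: ifP => // /x0.
Qed.

Lemma high_space0 : high_space 0 = fullv.
Proof. by apply/eqP; rewrite eqEsubv subvf; apply/subvP=> x _; apply/high_spaceP. Qed.

Lemma triangular_mul mu k x y : strictly_triangular mu ->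
  (x \in high_space k) || (y \in high_space k) -> amul mu x y \in high_space k.+1.
Proof.
move=> tri xy; apply/high_spaceP=> l; rewrite ltnS => le_lk; rewrite mxE.
apply: big1 => i _; apply: big1 => j _.
have [le_l | lt_l] := leqP l (maxn i j); first by rewrite tri ?mulr0.
have [lt_ik lt_jk] : (i < k)%N /\ (j < k)%N.
  by split; apply: leq_trans le_lk; apply: leq_ltn_trans lt_l; rewrite ?leq_maxl ?leq_maxr.
by case/orP: xy => /high_spaceP->; rewrite ?mulr0 ?mul0r.
Qed.

(** In a product of A^i and A^(m-i) with m at least 2^(k+1), one exponent is at least 2^k, so that
    factor lies in [high_space k] by induction and the product lies one level higher. *)
Lemma triangular_pow mu k m : strictly_triangular mu ->
  (2 ^ k <= m)%N -> (alg_pow mu m <= high_space k)%VS.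
Proof.
move=> tri; elim: k m => [|k IH] m le_m; first by rewrite high_space0 subvf.
rewrite alg_powE; last by apply: leq_trans le_m; rewrite expnS leq_pmulr ?expn_gt0.
rewrite big_seq; apply: (big_ind (fun U => U <= high_space k.+1)%VS) => [|U W sU sW|i]; rewrite ?sub0v ?subv_add ?sU //.
rewrite mem_index_iota => /andP[i_gt0 lt_im].
apply/subspace_mulP=> x y xi yi; apply: triangular_mul => //.
have [le_ki | lt_ik] := leqP (2 ^ k) i; first by rewrite (subvP (IH _ le_ki) x xi).
apply/orP; right; apply: (subvP (IH _ _) y yi).
by rewrite leq_subRL ?(ltnW lt_im) //; apply: leq_trans le_m; rewrite expnS mul2n -addnn leq_add2r ltnW.
Qed.

Lemma triangular_nilpotent mu : strictly_triangular mu -> nilpotent_algebra mu.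
Proof.
move=> tri; exists (2 ^ n)%N; first by rewrite expn_gt0.
apply/eqP; rewrite -subv0; apply: subv_trans (triangular_pow tri (leqnn _)) _.
apply/subvP=> x /high_spaceP x0; rewrite memv0; apply/eqP/colP=> i.
by rewrite mxE x0.
Qed.

(** The tails of such a list span a chain of two-sided ideals, and multiplication by any vector
    sends each into the next. *)
Fixpoint triangular_seq mu (s : seq 'cV[K]_n) : Prop :=
  if s is x :: s' then
    (forall y, amul mu x y \in <<s'>>%VS /\ amul mu y x \in <<s'>>%VS) /\
    triangular_seq mu s'
  else True.

Lemma alg_pow_mul mu i j x y : (0 < i)%N -> (0 < j)%N ->
  x \in alg_pow mu i -> y \in alg_pow mu j -> amul mu x y \in alg_pow mu (i + j).
Proof.
move=> i0 j0 xi yj; rewrite alg_powE; last by rewrite -(addn1 1) leq_add.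
have Hi : i \in index_iota 1 (i + j) by rewrite mem_index_iota i0 -[X in (X < _)%N]addn0 ltn_add2l.
rewrite (big_rem i Hi) /= -[amul mu x y]addr0 memv_add ?mem0v // addKn.
by move/subspace_mulP: (subvv (subspace_mul mu (alg_pow mu i) (alg_pow mu j))) => /(_ x y xi yj).
Qed.

(** The list grows at its head. If i is least with A^i inside the span of [s], a vector of A^(i-1)
    outside that span has all its products in A^i, hence in the span. *)
Lemma nilpotent_triangular_seq mu k : nilpotent_algebra mu -> (k <= n)%N ->
  exists s, [/\ size s = k, free s & triangular_seq mu s].
Proof.
move=> [m m_gt0 Am0]; elim: k => [|k IH] lt_kn.
  by exists [::]; split=> //; rewrite nil_free.
have [s [sz fr tri]] := IH (ltnW lt_kn).
have ex_m : exists i, (0 < i)%N && (alg_pow mu i <= <<s>>)%VS.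
  by exists m; rewrite m_gt0 Am0 sub0v.
have [[//|[|i]] /= As min_i] := ex_minnP ex_m.
  (* Least exponent 1 is impossible: fewer than [n] vectors would span the whole space. *)
  move: As; rewrite alg_pow1 => /dimvS; rewrite dimvf /dim /= muln1.
  by rewrite leqNgt (leq_ltn_trans (dim_span s)) ?sz.
have /subvPn[x xA xs] : ~~ (alg_pow mu i.+1 <= <<s>>)%VS.
  by apply/negP=> sub; have := min_i i.+1 sub; rewrite ltnn.
exists (x :: s); split; rewrite /= ?sz ?free_cons ?xs //; split=> // y.
have yA : y \in alg_pow mu 1 by rewrite alg_pow1 memvf.
split; apply: (subvP As); last exact: (alg_pow_mul (i := 1)).
by rewrite -[i.+2]addn1; apply: alg_pow_mul.
Qed.

Lemma triangular_seq_nth mu s i y : triangular_seq mu s -> (i < size s)%N ->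
  amul mu s`_i y \in <<drop i.+1 s>>%VS /\ amul mu y s`_i \in <<drop i.+1 s>>%VS.
Proof.
by elim: s i => // x s IH [|i] [xs /IH{}IH] /=; rewrite ?drop0 // ltnS; apply: IH.
Qed.

(** A triangular list of full length is a basis; the matrix [F] with these columns carries the
    standard basis to it, so its inverse makes the structure strictly triangular. *)
Lemma nilpotent_triangular mu : nilpotent_algebra mu ->
  exists2 nu, gl_orbit mu nu & strictly_triangular nu.
Proof.
move=> nil; have [s [sz fr tri]] := nilpotent_triangular_seq nil (leqnn n).
pose F : 'M[K]_n := \matrix_(i, j) s`_j i 0.
have colF j : F *m basis_vec K j = s`_j.
  by apply/colP=> i; rewrite /basis_vec -colE !mxE.
have FU : F \in unitmx.
  rewrite -unitmx_tr -row_free_unit -kermx_eq0; apply/rowV0P=> v /sub_kermxP vF.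
  have /freeP fr' : free (Tuple (introT eqP sz)) by [].
  apply/rowP=> j; rewrite mxE; apply: fr'.
  apply/colP=> i; have /rowP/(_ i) := vF; rewrite [LHS]mxE [RHS]mxE => vFi.
  by rewrite summxE [RHS]mxE -[RHS]vFi; apply: eq_bigr => l _; rewrite !mxE.
have coord x i (k : 'I_n) : x \in <<drop i s>>%VS -> (k < i)%N -> (invmx F *m x) k 0 = 0.
  move=> xs lt_ki.
  suff sub : (<<drop i s>> <= (linfun (mulmx (invmx F)) @^-1: high_space i))%VS.
    by have := subvP sub x xs; rewrite -memv_preim lfunE => /high_spaceP->.
  apply/span_subvP => _ /(nthP 0)[j lt_j <-]; rewrite nth_drop.
  rewrite size_drop sz ltn_subRL in lt_j.
  rewrite -memv_preim lfunE /= -(colF (Ordinal lt_j)) mulKmx //.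
  apply/high_spaceP=> l lt_li; rewrite !mxE; case: eqP => // eq_l.
  by move: lt_li; rewrite eq_l /= ltnNge leq_addr.
exists (gl_act (invmx F) mu); first by exists (invmx F); rewrite ?unitmx_inv.
move=> i j k le_k; rewrite ffunE /= invmxK !colF.
have [le_ki | lt_ik] := leqP k i.
  by apply: (coord _ i.+1) => //; case: (triangular_seq_nth (mu := mu) (s := s) (i := i) s`_j tri) => //; rewrite sz.
apply: (coord _ j.+1); last by move: le_k; rewrite leq_max leqNgt lt_ik.
by case: (triangular_seq_nth (mu := mu) (s := s) (i := j) s`_i tri) => //; rewrite sz.
Qed.

End Triangular.

(** * Triangular structures in dimension four *)

Section DimensionFour.
Variable K : fieldType.
Implicit Types (mu nu : alg_struct K 4) (n : nat -> nat -> K).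

Local Notation ord4 i := (@Ordinal 4 i isT).

Definition col4 (p q r s : K) : 'cV[K]_4 := \col_k nth 0 [:: p; q; r; s] k.

Lemma col4E (x : 'cV[K]_4) :
  x = col4 (x (ord4 0) 0) (x (ord4 1) 0) (x (ord4 2) 0) (x (ord4 3) 0).
Proof.
apply/colP=> -[[|[|[|[|//]]]] lt_i4]; rewrite mxE /=; congr (x _ _); exact: val_inj.
Qed.

Lemma col4D p q r s p' q' r' s' :
  col4 p q r s + col4 p' q' r' s' = col4 (p + p') (q + q') (r + r') (s + s').
Proof. by apply/colP=> -[[|[|[|[|//]]]] lt_i4]; rewrite !mxE. Qed.

Lemma col4B p q r s p' q' r' s' :
  col4 p q r s - col4 p' q' r' s' = col4 (p - p') (q - q') (r - r') (s - s').
Proof. by apply/colP=> -[[|[|[|[|//]]]] lt_i4]; rewrite !mxE. Qed.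

Lemma col4Z a p q r s : a *: col4 p q r s = col4 (a * p) (a * q) (a * r) (a * s).
Proof. by apply/colP=> -[[|[|[|[|//]]]] lt_i4]; rewrite !mxE. Qed.

Lemma sum_ord4 (F : 'I_4 -> K) :
  \sum_i F i = F (ord4 0) + F (ord4 1) + F (ord4 2) + F (ord4 3).
Proof.
rewrite !big_ord_recr big_ord0 /= add0r.
by congr (F _ + F _ + F _ + F _); apply: val_inj.
Qed.

(* Products on the basis e_0, ..., e_3:
   e_0 e_0 = a e_1 + b e_2 + ..., e_0 e_1 = u e_2 + ..., e_1 e_0 = v e_2 + ...,
   e_1 e_1 = w e_2 + ..., and n i j is the coefficient of e_3 in e_i e_j. *)
Definition tri4_coef (a b u v w : K) n (i j k : nat) : K :=
  match k with
  | 1%N => if (i == 0%N) && (j == 0%N) then a else 0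
  | 2%N => nth 0 (nth [::] [:: [:: b; u]; [:: v; w]] i) j
  | 3%N => if (i < 3)%N && (j < 3)%N then n i j else 0
  | _ => 0
  end.

Definition tri4 a b u v w n : alg_struct K 4 :=
  [ffun t : 'I_4 * 'I_4 * 'I_4 => tri4_coef a b u v w n t.1.1 t.1.2 t.2].

Lemma tri4_mul a b u v w n x0 x1 x2 x3 y0 y1 y2 y3 :
  amul (tri4 a b u v w n) (col4 x0 x1 x2 x3) (col4 y0 y1 y2 y3) =
  col4 0 (a * x0 * y0) (b * x0 * y0 + u * x0 * y1 + v * x1 * y0 + w * x1 * y1)
    (n 0%N 0%N * x0 * y0 + n 0%N 1%N * x0 * y1 + n 0%N 2%N * x0 * y2 +
     n 1%N 0%N * x1 * y0 + n 1%N 1%N * x1 * y1 + n 1%N 2%N * x1 * y2 +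
     n 2%N 0%N * x2 * y0 + n 2%N 1%N * x2 * y1 + n 2%N 2%N * x2 * y2).
Proof.
apply/colP=> -[[|[|[|[|//]]]] lt_k4]; rewrite !mxE sum_ord4 !sum_ord4 !mxE !ffunE /=; ring.
Qed.

Lemma triangular_tri4 mu : strictly_triangular mu ->
  exists a b u v w n, mu = tri4 a b u v w n.
Proof.
move=> tri; pose c i j k : K := mu (inord i, inord j, inord k).
exists (c 0 0 1)%N, (c 0 0 2)%N, (c 0 1 2)%N, (c 1 0 2)%N, (c 1 1 2)%N.
exists (fun i j => c i j 3%N).
apply/ffunP=> -[[i j] k]; rewrite ffunE /=.
case: i j k => [[|[|[|[|//]]]] lt_i] [[|[|[|[|//]]]] lt_j] [[|[|[|[|//]]]] lt_k];
  first [by rewrite tri | by congr (mu (_, _, _)); apply: val_inj; rewrite /= inordK].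
Qed.

Lemma tri4_triangular a b u v w n : strictly_triangular (tri4 a b u v w n).
Proof.
move=> i j k; rewrite ffunE /=.
by case: i j k => [[|[|[|[|//]]]] lt_i] [[|[|[|[|//]]]] lt_j] [[|[|[|[|//]]]] lt_k].
Qed.

Lemma op_comm_linear m (f h : 'cV[K]_m -> 'cV[K]_m) :
  linear f -> linear h -> linear (op_comm f h).
Proof.
move=> fL hL a x y; rewrite /op_comm hL fL fL hL.
by rewrite opprD addrACA scalerBr.
Qed.

(** Commutators of multiplication operators are linear because the product is bilinear, so only the
    Leibniz rule remains. *)
Lemma CD_algebraP mu :
  (forall x y z t : 'cV[K]_4,
    [/\ op_comm (lmulop mu x) (lmulop mu y) (amul mu z t) =
          amul mu (op_comm (lmulop mu x) (lmulop mu y) z) t +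
          amul mu z (op_comm (lmulop mu x) (lmulop mu y) t),
        op_comm (lmulop mu x) (rmulop mu y) (amul mu z t) =
          amul mu (op_comm (lmulop mu x) (rmulop mu y) z) t +
          amul mu z (op_comm (lmulop mu x) (rmulop mu y) t) &
        op_comm (rmulop mu x) (rmulop mu y) (amul mu z t) =
          amul mu (op_comm (rmulop mu x) (rmulop mu y) z) t +
          amul mu z (op_comm (rmulop mu x) (rmulop mu y) t)]) ->
  CD_algebra mu.
Proof.
move=> der x y.
have lL z := amul_linearr mu z; have rL z := amul_linearl mu z.
split; split=> [|z t]; try (by case: (der x y z t)).
- exact: op_comm_linear (lL x) (lL y).
- exact: op_comm_linear (lL x) (rL y).
- exact: op_comm_linear (rL x) (rL y).
Qed.

Definition tri4E := (tri4_mul, col4D, col4B, col4Z).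

(** Products lie in <e_2, e_3> and triple products in <e_3>, which annihilates everything. A
    commutator of multiplications thus maps into <e_3> and kills products, and both sides of the
    Leibniz rule vanish. *)
Lemma tri4_CD0 b u v w n : nilpotent_CD (tri4 0 b u v w n).
Proof.
split; first by apply: triangular_nilpotent; apply: tri4_triangular.
apply: CD_algebraP => x y z t.
rewrite (col4E x) (col4E y) (col4E z) (col4E t) /op_comm /lmulop /rmulop.
by rewrite !tri4E; split; congr col4; ring.
Qed.

(** The parameter [s] solves the quadric of [tri4_CD_eqs], so [u], [v] and [s] can be moved
    independently without leaving the variety. *)
Lemma tri4_CD_quadric a b u v s n :
  n 1%N 2%N = 0 -> n 2%N 1%N = 0 -> n 2%N 2%N = 0 ->
  n 0%N 2%N = s * (2 * u - v) -> n 2%N 0%N = s * (2 * v - u) ->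
  nilpotent_CD (tri4 a b u v 0 n).
Proof.
move=> n12 n21 n22 n02 n20.
split; first by apply: triangular_nilpotent; apply: tri4_triangular.
apply: CD_algebraP => x y z t.
rewrite (col4E x) (col4E y) (col4E z) (col4E t) /op_comm /lmulop /rmulop.
by rewrite !tri4E n12 n21 n22 n02 n20; split; congr col4; ring.
Qed.

End DimensionFour.

(** * Consequences of the CD conditions and normal forms *)

Section NormalForm.
Variable K : fieldType.
Implicit Types (mu nu : alg_struct K 4) (n : nat -> nat -> K).

Local Notation ord4 i := (@Ordinal 4 i isT).
Local Notation e0 := (col4 (1 : K) 0 0 0).
Local Notation e1 := (col4 (0 : K) 1 0 0).
Local Notation e2 := (col4 (0 : K) 0 1 0).

(** Derives an equation from a hypothesis and an explicit factor [c], leaving a polynomial identity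
    for [ring]. *)
Lemma eq_sub_scale (c p q x y : K) : p = q -> x - y = c * (p - q) -> x = y.
Proof. by move=> ->; rewrite subrr mulr0 => /eqP; rewrite subr_eq0 => /eqP. Qed.

(** Takes the coefficient of e_3 in an instance of the Leibniz rule, which is the wanted equation up
    to sign. *)
Local Ltac coord3 D :=
  have := D; rewrite /op_comm /lmulop /rmulop !tri4E
    => /(congr1 (fun x : 'cV[K]_4 => x (ord4 3) 0));
  rewrite [LHS]mxE [RHS]mxE /=; let E := fresh in intro E;
  first [ by apply: (eq_sub_scale (c := 1) E); ring
        | by apply: (eq_sub_scale (c := -1) E); ring ].

(** Each equation, multiplied by [a], is the coefficient of e_3 in a Leibniz rule on basis vectors.
    The first one, the quadric, comes from [L, R] for e_0 applied to e_0 e_0. *)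
Lemma tri4_CD_eqs a b u v w n : CD_algebra (tri4 a b u v w n) -> a != 0 ->
  [/\ (2 * v - u) * n 0%N 2%N = (2 * u - v) * n 2%N 0%N,
      [/\ u * n 2%N 2%N = 0, v * n 2%N 2%N = 0 & w * n 2%N 2%N = 0],
      w * n 1%N 2%N = 0 /\ w * n 2%N 1%N = 0,
      u * n 1%N 2%N = w * (2 * n 0%N 2%N + n 2%N 0%N) /\
      v * n 1%N 2%N = w * (n 0%N 2%N + 2 * n 2%N 0%N) &
      u * n 2%N 1%N = w * (2 * n 0%N 2%N + n 2%N 0%N) /\
      v * n 2%N 1%N = w * (n 0%N 2%N + 2 * n 2%N 0%N)].
Proof.
move=> CD an0; have red p q : a * p = a * q -> p = q by exact: mulfI.
have LL x y z t : _ := let: And3 (conj _ D) _ _ := CD x y in D z t.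
have LR x y z t : _ := let: And3 _ (conj _ D) _ := CD x y in D z t.
have RR x y z t : _ := let: And3 _ _ (conj _ D) := CD x y in D z t.
split; [|split|split|split|split]; apply: red.
- coord3 (LR e0 e0 e0 e0).
- coord3 (LL e2 e0 e0 e0).
- coord3 (LR e2 e0 e0 e0).
- coord3 (LL e1 e0 e0 e2).
- coord3 (LL e1 e0 e1 e0).
- coord3 (LL e1 e0 e0 e1).
- coord3 (LL e1 e0 e0 e0).
- coord3 (LR e1 e0 e0 e0).
- coord3 (LR e0 e1 e0 e0).
- coord3 (RR e0 e1 e0 e0).
Qed.

(** Missing entries default to 0, so rows are written without their trailing zeros. *)
Definition mx4 (A : seq (seq K)) : 'M[K]_4 := \matrix_(i, j) nth 0 (nth [::] A i) j.

Lemma mx4_col4 A p q r s :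
  let dot i := nth 0 (nth [::] A i) 0 * p + nth 0 (nth [::] A i) 1 * q +
               nth 0 (nth [::] A i) 2 * r + nth 0 (nth [::] A i) 3 * s in
  mx4 A *m col4 p q r s = col4 (dot 0%N) (dot 1%N) (dot 2%N) (dot 3%N).
Proof.
by move=> dot; apply/colP=> -[[|[|[|[|//]]]] lt_i4]; rewrite mxE sum_ord4 !mxE.
Qed.

Lemma mx4_unit A B : mx4 A *m mx4 B = 1%:M -> mx4 A \in unitmx.
Proof. by case/mulmx1_unit. Qed.

Lemma gl_orbit_mx4 A mu nu : mx4 A \in unitmx ->
  (forall x0 x1 x2 x3 y0 y1 y2 y3,
     let x := col4 x0 x1 x2 x3 in let y := col4 y0 y1 y2 y3 in
     amul nu (mx4 A *m x) (mx4 A *m y) = mx4 A *m amul mu x y) ->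
  gl_orbit mu nu.
Proof.
move=> AU iso; exists (mx4 A) => //; apply: gl_act_iso => // x y.
by rewrite (col4E x) (col4E y) iso.
Qed.

(* The new basis is e_0, e_1, e_3, e_1 e_1. *)
Lemma tri4_orbit_w0 a b u v w n : w != 0 ->
  n 0%N 2%N = 0 -> n 2%N 0%N = 0 -> n 1%N 2%N = 0 -> n 2%N 1%N = 0 -> n 2%N 2%N = 0 ->
  exists b' u' v' n', gl_orbit (tri4 a b u v w n) (tri4 a b' u' v' 0 n').
Proof.
move=> wn0 n02 n20 n12 n21 n22; pose d := n 1%N 1%N / w.
exists (n 0%N 0%N - b * d), (n 0%N 1%N - u * d), (n 1%N 0%N - v * d).
exists (fun i j => nth 0 (nth [::] [:: [:: b / w; u / w]; [:: v / w; 1]] i) j).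
(* The matrix converts old coordinates to the new basis f: since e_1 e_1 = w (e_2 + d e_3), one has
   e_2 = f_3 / w - d f_2 and e_3 = f_2. *)
apply: (@gl_orbit_mx4 [:: [:: 1]; [:: 0; 1]; [:: 0; 0; - d; 1]; [:: 0; 0; w^-1]]).
  apply: (@mx4_unit _ [:: [:: 1]; [:: 0; 1]; [:: 0; 0; 0; w]; [:: 0; 0; 1; d * w]]).
  apply/matrixP=> -[[|[|[|[|//]]]] lt_i4] [[|[|[|[|//]]]] lt_j4];
    rewrite mxE sum_ord4 !mxE /=; by field.
move=> x0 x1 x2 x3 y0 y1 y2 y3 /=; rewrite tri4_mul !mx4_col4 /= tri4_mul /= n02 n20 n12 n21 n22 /d.
by congr col4; field.
Qed.

(* The new basis is e_0, e_2, a e_1 + b e_2, e_3. *)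
Lemma tri4_orbit_a0 a b n : a != 0 ->
  exists n', gl_orbit (tri4 a b 0 0 0 n) (tri4 0 1 0 0 0 n').
Proof.
move=> an0.
exists (fun i j => nth 0 (nth [::]
  [:: [:: n 0%N 0%N; n 0%N 2%N; a * n 0%N 1%N + b * n 0%N 2%N];
      [:: n 2%N 0%N; n 2%N 2%N; a * n 2%N 1%N + b * n 2%N 2%N];
      [:: a * n 1%N 0%N + b * n 2%N 0%N; a * n 1%N 2%N + b * n 2%N 2%N;
          a ^+ 2 * n 1%N 1%N + a * b * (n 1%N 2%N + n 2%N 1%N) + b ^+ 2 * n 2%N 2%N]] i) j).
apply: (@gl_orbit_mx4 [:: [:: 1]; [:: 0; - b / a; 1]; [:: 0; a^-1]; [:: 0; 0; 0; 1]]).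
  apply: (@mx4_unit _ [:: [:: 1]; [:: 0; 0; a]; [:: 0; 1; b]; [:: 0; 0; 0; 1]]).
  apply/matrixP=> -[[|[|[|[|//]]]] lt_i4] [[|[|[|[|//]]]] lt_j4];
    rewrite mxE sum_ord4 !mxE /=; by field.
move=> x0 x1 x2 x3 y0 y1 y2 y3 /=; rewrite tri4_mul !mx4_col4 /= tri4_mul /=.
by congr col4; field.
Qed.

Definition quadric_form nu := exists a b u v s n,
  [/\ nu = tri4 a b u v 0 n, a != 0, (u != 0) || (v != 0),
      n 1%N 2%N = 0 /\ n 2%N 1%N = 0 &
      [/\ n 2%N 2%N = 0, n 0%N 2%N = s * (2 * u - v) & n 2%N 0%N = s * (2 * v - u)]].

Hypothesis charK : [pchar K] =i pred0.

(** In characteristic zero 2u - v and 2v - u vanish together only for u = v = 0, so the linear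
    relation makes (p, q) a multiple of (2u - v, 2v - u). *)
Lemma proportional_quadric (u v p q : K) : (u != 0) || (v != 0) ->
  (2 * v - u) * p = (2 * u - v) * q ->
  exists s, p = s * (2 * u - v) /\ q = s * (2 * v - u).
Proof.
move=> uv0 E; have [uv|uv] := eqVneq (2 * u - v) 0; last first.
  exists (p / (2 * u - v)); split; first by rewrite divfK.
  by apply: (mulfI uv); rewrite -E; field.
have three : (3 : K) != 0 by rewrite (pcharf0P K).1.
have defv : v = 2 * u by apply/esym/eqP; rewrite -subr_eq0 uv.
have u0 : u != 0 by move: uv0; rewrite defv; case: eqVneq => // ->; rewrite mulr0 eqxx.
have vu : 2 * v - u != 0.
  by rewrite defv (_ : _ - u = 3 * u); [rewrite mulf_neq0 | ring].
exists (q / (2 * v - u)); rewrite divfK //; split=> //.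
by apply: (mulfI vu); rewrite E uv; ring.
Qed.

(** If u = v = 0, a change of basis leads back to a = 0. Otherwise, with w = 0, the CD equations
    have zero right-hand sides, and a nonzero [u] or [v] can be cancelled. *)
Lemma tri4_w0_normal_form a b u v n : nilpotent_CD (tri4 a b u v 0 n) ->
  exists2 nu, gl_orbit (tri4 a b u v 0 n) nu &
    (exists b u v w n, nu = tri4 0 b u v w n) \/ quadric_form nu.
Proof.
move=> [_ CD]; have [->|an0] := eqVneq a 0.
  by exists (tri4 0 b u v 0 n); [apply: gl_orbit_refl | left; exists b, u, v, 0, n].
have [[-> ->]|uv0] : (u = 0 /\ v = 0) \/ (u != 0) || (v != 0).
- by case: eqVneq; case: eqVneq; auto.
- have [n' orb] := tri4_orbit_a0 b n an0.
  by exists (tri4 0 1 0 0 0 n') => //; left; exists 1, 0, 0, 0, n'.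
exists (tri4 a b u v 0 n); [exact: gl_orbit_refl | right].
have [E [u22 v22 _] _ [u12 v12] [u21 v21]] := tri4_CD_eqs CD an0.
have [s [n02 n20]] := proportional_quadric uv0 E.
have cancel_uv x : u * x = 0 -> v * x = 0 -> x = 0.
  by case/orP: uv0 => [/mulfI u_inj ux _ | /mulfI v_inj _ vx];
    [apply: u_inj | apply: v_inj]; rewrite mulr0.
exists a, b, u, v, s, n; split=> //; split=> //; try by apply: cancel_uv.
- by apply: cancel_uv; rewrite ?u12 ?v12 mul0r.
- by apply: cancel_uv; rewrite ?u21 ?v21 mul0r.
Qed.

(** The hypothesis holds for an open orbit, which is by definition a subset of the variety; it
    replaces a proof that the variety is stable under GL(V). *)
Lemma nilpotent_CD_normal_form mu :
  (forall nu, gl_orbit mu nu -> nilpotent_CD nu) ->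
  exists2 nu, gl_orbit mu nu &
    (exists b u v w n, nu = tri4 0 b u v w n) \/ quadric_form nu.
Proof.
move=> orbN; have [nil _] := orbN mu (gl_orbit_refl mu).
have [nu orb /triangular_tri4[a [b [u [v [w [n def_nu]]]]]]] := nilpotent_triangular nil.
have [_ CD] := orbN nu orb; rewrite {}def_nu in orb CD.
have reduce_w0 b' u' v' n' : gl_orbit mu (tri4 a b' u' v' 0 n') ->
  exists2 nu, gl_orbit mu nu & (exists b u v w n, nu = tri4 0 b u v w n) \/ quadric_form nu.
  move=> orb'; have [nu' /(gl_orbit_trans orb')] := tri4_w0_normal_form (orbN _ orb').
  by exists nu'.
have [w0|wn0] := eqVneq w 0; first by rewrite w0 in orb; apply: reduce_w0 orb.
have [a0|an0] := eqVneq a 0.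
  by exists (tri4 a b u v w n) => //; left; exists b, u, v, w, n; rewrite a0.
have [_ [_ _ w22] [w12 w21] [u12 v12] _] := tri4_CD_eqs CD an0.
have cancel_w x : w * x = 0 -> x = 0 by move/eqP; rewrite mulf_eq0 (negPf wn0) => /eqP.
have n22 := cancel_w _ w22; have n12 := cancel_w _ w12; have n21 := cancel_w _ w21.
have p0 : 2 * n 0%N 2%N + n 2%N 0%N = 0 by apply: cancel_w; rewrite -u12 n12 mulr0.
have q0 : n 0%N 2%N + 2 * n 2%N 0%N = 0 by apply: cancel_w; rewrite -v12 n12 mulr0.
(* The linear system [p0], [q0] in the coefficients of e_3 in e_0 e_2 and e_2 e_0 has determinant
   3. *)
have three : (3 : K) != 0 by rewrite (pcharf0P K).1.
have n02 : n 0%N 2%N = 0.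
  apply: (mulfI three).
  transitivity (2 * (2 * n 0%N 2%N + n 2%N 0%N) - (n 0%N 2%N + 2 * n 2%N 0%N)); first by ring.
  by rewrite p0 q0 !mulr0 subr0.
have n20 : n 2%N 0%N = 0 by move: p0; rewrite n02 mulr0 add0r.
have [b' [u' [v' [n' orb']]]] := tri4_orbit_w0 a b u v wn0 n02 n20 n12 n21 n22.
by apply: reduce_w0; apply: gl_orbit_trans orb'; apply: orb.
Qed.

End NormalForm.

(** * Identities that detect the moduli *)

Section Identities.
Variables (K : fieldType) (m : nat).
Implicit Types (mu nu : alg_struct K m) (A B : K).

(** On [tri4 0 b u v w n], with d = x_0 y_1 - x_1 y_0, the two sides are the multiples of e_3 by
    n_22 d^2 A (4bw - (u + v)^2) and n_22 d^2 B (u - v)^2. The identity thus fixes the modulus of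
    the form when e_2 e_2 is nonzero. *)
Definition quartic_identity A B mu := forall x y : 'cV[K]_m,
  let xy := amul mu x y in let yx := amul mu y x in
  A *: (4 *: amul mu (amul mu x x) (amul mu y y) - amul mu (xy + yx) (xy + yx)) =
  B *: amul mu (xy - yx) (xy - yx).

(** On a quadric form the e_2 coefficient of the right factor is (A u - B v) a x_0^3, and left
    multiplication by [y] kills its e_3 part. So [A = v], [B = u] works, and the identity fixes
    [u : v] when e_0 e_2 is nonzero. *)
Definition cubic_identity A B mu := forall x y : 'cV[K]_m,
  let xx := amul mu x x in
  amul mu y (A *: amul mu x xx - B *: amul mu xx x) = 0.

Lemma quartic_identity_orbit A B mu nu :
  gl_orbit mu nu -> quartic_identity A B mu -> quartic_identity A B nu.
Proof.
move=> [g gU ->] id_mu x y /=; rewrite !(amul_gl_act, mulmxBr, mulmxDr, mulKmx gU).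
by rewrite !scalemxAr -mulmxBr scalemxAr id_mu.
Qed.

Lemma cubic_identity_orbit A B mu nu :
  gl_orbit mu nu -> cubic_identity A B mu -> cubic_identity A B nu.
Proof.
move=> [g gU ->] id_mu x y /=; rewrite !(amul_gl_act, mulKmx gU) !scalemxAr.
by rewrite -mulmxBr mulKmx // id_mu mulmx0.
Qed.

End Identities.

(** * Deformations that leave the orbit *)

Section NoRigid.
Variable K : fieldType.
Hypothesis charK : [pchar K] =i pred0.
Implicit Types (mu nu : alg_struct K 4) (n : nat -> nat -> K).

Local Notation ord4 i := (@Ordinal 4 i isT).
Local Notation e0 := (col4 (1 : K) 0 0 0).
Local Notation e1 := (col4 (0 : K) 1 0 0).

Local Ltac polyfun := repeat first
  [ exact: polyfun_cst | exact: polyfun_segment | exact: polyfun_id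
  | apply: polyfunN | apply: polyfunX | apply: polyfunD | apply: polyfunM ].

Lemma polyfun_tri4 (a b u v w : K -> K) (n : K -> nat -> nat -> K) i :
  polyfun a -> polyfun b -> polyfun u -> polyfun v -> polyfun w ->
  (forall j k, polyfun (fun t => n t j k)) ->
  polyfun (fun t => tri4 (a t) (b t) (u t) (v t) (w t) (n t) i).
Proof.
move=> aP bP uP vP wP nP; under [X in polyfun X]funext do rewrite ffunE.
case: i => [[i j] k] /=.
by case: i j k => [[|[|[|[|//]]]] lt_i] [[|[|[|[|//]]]] lt_j] [[|[|[|[|//]]]] lt_k] //=;
  apply: polyfun_cst.
Qed.

Lemma tri4_quartic_identity b u v w n A B :
  A * (4 * b * w - (u + v) ^+ 2) = B * (u - v) ^+ 2 ->
  quartic_identity A B (tri4 0 b u v w n).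
Proof.
move=> AB x y /=; rewrite (col4E x) (col4E y) !tri4E; congr col4; try by ring.
pose d := x (ord4 0) 0 * y (ord4 1) 0 - x (ord4 1) 0 * y (ord4 0) 0.
by apply: (eq_sub_scale (c := n 2%N 2%N * d ^+ 2) AB); rewrite /d; ring.
Qed.

Lemma tri4_a0_not_rigid mu b u v w n :
  rigid_in (@nilpotent_CD K 4) mu -> ~ gl_orbit mu (tri4 0 b u v w n).
Proof.
move=> rigid orb; pose S b u v w : K := 4 * b * w - (u + v) ^+ 2.
pose T u v : K := (u - v) ^+ 2.
(* The pair (A, B) gives an identity of the starting structure, violated by a form with b = w = 0: u
   = v = 1 has S = -4, T = 0 and works if A is nonzero; u = 1, v = 0 has T = 1 and works if A =
   0. *)
have [A [B [AB [u1 [v1 uv1]]]]] : exists A B, A * S b u v w = B * T u v /\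
    exists u1 v1, A * S 0 u1 v1 0 - B * T u1 v1 != 0.
  have four : (4 : K) != 0 by rewrite (pcharf0P K).1.
  have [S0|Sn0] := eqVneq (S b u v w) 0.
    exists 1, 0; split; [by rewrite S0 mulr0 mul0r | exists 1, 1].
    by rewrite (_ : _ - _ = - 4) ?oppr_eq0 // /S; ring.
  exists (T u v), (S b u v w); split; first exact: mulrC.
  have [T0|Tn0] := eqVneq (T u v) 0.
    by exists 1, 0; rewrite T0 mul0r sub0r /T subr0 expr1n mulr1 oppr_eq0.
  exists 1, 1; rewrite (_ : _ - _ = - (4 * T u v)); last by rewrite /S /T; ring.
  by rewrite oppr_eq0 mulf_neq0.
(* All coefficients of e_3 move to 1, so that e_2 e_2 is nonzero at t = 1 and the quartic identity
   becomes effective. *)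
pose nu t := tri4 0 (segment b 0 t) (segment u u1 t) (segment v v1 t) (segment w 0 t)
  (fun i j => segment (n i j) 1 t).
pose J t := segment (n 2%N 2%N) 1 t *
  (A * S (segment b 0 t) (segment u u1 t) (segment v v1 t) (segment w 0 t) -
   B * T (segment u u1 t) (segment v v1 t)).
have [t Jt orb_t] : exists2 t, J t != 0 & gl_orbit mu (nu t).
  apply: (rigid_curve charK rigid) => [t|i|||].
  - exact: tri4_CD0.
  - by apply: polyfun_tri4 => *; polyfun.
  - rewrite /nu !segment0 (_ : (fun i j => _) = n) //.
    by apply/funext=> i; apply/funext=> j; rewrite segment0.
  - by rewrite /J /S /T; polyfun.
  - by exists 1; rewrite /J !segment1 mul1r.
have id_t : quartic_identity A B (nu t).
  apply: quartic_identity_orbit (gl_orbit_trans (gl_orbit_sym orb) orb_t) _.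
  exact: tri4_quartic_identity.
(* At x = e_0, y = e_1 one has d = 1, and the e_3 coefficients of the two sides differ by exactly
   [J t]. *)
case/eqP: Jt; have := id_t e0 e1; rewrite /= !tri4E.
move=> /(congr1 (fun x : 'cV[K]_4 => x (ord4 3) 0)).
rewrite [LHS]mxE [RHS]mxE /= => E.
by apply: (eq_sub_scale (c := 1) E); rewrite /J /S /T; ring.
Qed.

Lemma tri4_cubic_identity a b u v n :
  n 1%N 2%N = 0 -> n 2%N 1%N = 0 -> n 2%N 2%N = 0 ->
  cubic_identity v u (tri4 a b u v 0 n).
Proof.
move=> n12 n21 n22 x y /=; rewrite (col4E x) (col4E y) !tri4E n12 n21 n22.
by apply/colP=> -[[|[|[|[|//]]]] lt_i4]; rewrite !mxE //=; ring.
Qed.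

Lemma quadric_form_not_rigid mu nu :
  rigid_in (@nilpotent_CD K 4) mu -> quadric_form nu -> ~ gl_orbit mu nu.
Proof.
move=> rigid [a [b [u [v [s [n [-> an0 uv0 [n12 n21] [n22 n02 n20]]]]]]]] orb.
(* The endpoint must not be proportional to (u, v), and must satisfy 2 u1 - v1 <> 0 so that e_0 e_2
   is nonzero there when s = 1. *)
have [u1 [v1 uv1]] : exists u1 v1, (2 * u1 - v1) * (v * u1 - u * v1) != 0.
  case/orP: uv0 => [un0|vn0].
    by exists 0, 1; rewrite (_ : _ * (_ - _) = u) //; ring.
  have two : (2 : K) != 0 by rewrite (pcharf0P K).1.
  by exists 1, 0; rewrite (_ : _ * (_ - _) = 2 * v) ?mulf_neq0 //; ring.
pose ut := segment u u1; pose vt := segment v v1; pose st := segment s 1.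
(* Only the coefficients of e_3 in e_0 e_2 and e_2 e_0 follow the moving parameters, which keeps the
   curve on the quadric. *)
pose nt t i j := match i, j with
  | 0%N, 2%N => st t * (2 * ut t - vt t)
  | 2%N, 0%N => st t * (2 * vt t - ut t)
  | _, _ => n i j
  end.
pose nu_ t := tri4 a b (ut t) (vt t) 0 (nt t).
pose J t := st t * (2 * ut t - vt t) * a * (v * ut t - u * vt t).
have [t Jt orb_t] : exists2 t, J t != 0 & gl_orbit mu (nu_ t).
  apply: (rigid_curve charK rigid) => [t|i|||].
  - exact: tri4_CD_quadric.
  - apply: polyfun_tri4 => [|||||[|[|[|j]]] [|[|[|k]]]]; rewrite /nt /ut /vt /st; polyfun.
  - rewrite /nu_ /ut /vt !segment0 (_ : nt 0 = n) //.
    apply/funext=> -[|[|[|i]]]; apply/funext=> -[|[|[|j]]] //=;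
      by rewrite /st /ut /vt !segment0.
  - by rewrite /J /st /ut /vt; polyfun.
  - by exists 1; rewrite /J /st /ut /vt !segment1 mul1r mulrAC mulf_neq0.
have id_t : cubic_identity v u (nu_ t).
  apply: cubic_identity_orbit (gl_orbit_trans (gl_orbit_sym orb) orb_t) _.
  exact: tri4_cubic_identity.
(* At x = y = e_0 the left side of the cubic identity is [J t] times e_3. *)
case/eqP: Jt; have := id_t e0 e0; rewrite /= !tri4E.
move=> /(congr1 (fun x : 'cV[K]_4 => x (ord4 3) 0)); rewrite !mxE /= => E.
by apply: (eq_sub_scale (c := 1) E); rewrite /J; ring.
Qed.

Lemma no_rigid_nilpotent_CD4 : ~ exists mu, rigid_in (@nilpotent_CD K 4) mu.
Proof.
move=> [mu rigid]; have [_ [U _ defO]] := rigid.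
have orbN nu : gl_orbit mu nu -> nilpotent_CD nu by rewrite defO => -[].
have [nu orb [[b [u [v [w [n def_nu]]]]]|form]] := nilpotent_CD_normal_form charK orbN.
  by rewrite def_nu in orb; apply: tri4_a0_not_rigid rigid orb.
exact: quadric_form_not_rigid rigid form orb.
Qed.

End NoRigid.

Theorem mainTheorem2 (R : realType) :
  ~ exists mu : alg_struct R[i] 4, rigid_in (@nilpotent_CD R[i] 4) mu.
Proof. exact: no_rigid_nilpotent_CD4 (Num.Theory.pchar_num R[i]). Qed.
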